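(* Let $m\in\mathbb{N}$, $q\in[0.5,1)$, and weights $w_1,\ldots,w_m\ge 0$ with $\sum_j w_j>0$. Let $\mu_1,\ldots,\mu_m,\tilde\epsilon_1,\ldots,\tilde\epsilon_m$ be mutually independent real random variables, where $\tilde\epsilon_1,\ldots,\tilde\epsilon_m$ have finite means and variances and $\mu_1,\ldots,\mu_m$ have one common bounded probability density. For $t>0$ set $\lambda_i^t=t\mu_i+\tilde\epsilon_i$. Let $v$ be the weighted voting game $[q^m;w_1,\ldots,w_m]$ and $\phi(v)$ its Shapley value. Then for $i,j\in\{1,\ldots,m\}$ with $\phi_j(v)>0$, $$\lim_{t\to\infty}\frac{\pi_i(\mathcal{R}^{m,q,t})}{\pi_j(\mathcal{R}^{m,q,t})}=\frac{\phi_i(v)}{\phi_j(v)}.$$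
   Context: The quota is $q^m=q\sum_{j=1}^m w_j$. For a realization of $\lambda_1^t,\ldots,\lambda_m^t$ (ties ignored), let $k{:}m$ be the index of the representative with the $k$-th smallest ideal point and $w_{k:m}$ its weight; the pivotal position is $P=\min\{j:\sum_{k=1}^j w_{k:m}>q^m\}$, and $\pi_i(\mathcal{R}^{m,q,t})=\Pr(P{:}m=i)$ when ideal points are $\lambda^t_1,\ldots,\lambda^t_m$. The weighted voting game $[q^m;w_1,\ldots,w_m]$ is the simple game on $\{1,\ldots,m\}$ with $v(S)=1$ if $\sum_{j\in S}w_j>q^m$ and $v(S)=0$ otherwise. Its Shapley value is $\phi_i(v)=\sum_{S\subseteq\{1,\ldots,m\}\setminus\{i\}}\frac{|S|!(m-|S|-1)!}{m!}[v(S\cup\{i\})-v(S)]$. *)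

(* Defs.v *)
From HB Require Import structures.
From mathcomp Require Import all_boot all_order all_algebra.
From mathcomp Require Import all_classical all_reals all_analysis.
Set Implicit Arguments. Unset Strict Implicit. Unset Printing Implicit Defensive.
Import Order.TTheory GRing.Theory Num.Theory.
Import numFieldNormedType.Exports.
Local Open Scope classical_set_scope.
Local Open Scope ring_scope.

(* Mutual independence of a finite family of real random variables:
   the product rule for every choice of Borel sets (choosing [setT] for some
   indices covers every subfamily). *)
Definition mutually_independent {d} {T : measurableType d} {R : realType}
  (P : probability T R) (I : finType) (X : I -> T -> R) : Prop :=
  forall B : I -> set R, (forall i, measurable (B i)) ->
    P (\bigcap_(i in [set: I]) (X i @^-1` B i)) =
    (\prod_(i : I) P (X i @^-1` B i))%E.

Definition quota {R : realType} (m : nat) (q : R) (w : 'I_m -> R) : R :=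
  q * \sum_(j < m) w j.

Definition wvg {R : realType} (m : nat) (q : R) (w : 'I_m -> R)
  (S : {set 'I_m}) : R :=
  if quota q w < \sum_(j in S) w j then 1 else 0.

Definition shapley {R : realType} (m : nat) (v : {set 'I_m} -> R)
  (i : 'I_m) : R :=
  \sum_(S : {set 'I_m} | i \notin S)
     (((#|S|)`! * (m - #|S| - 1)`!)%:R / (m`!)%:R) * (v (i |: S) - v S).

(* Representatives sorted by ideal point (ties broken by index; ties have
   probability zero in the theorem). *)
Definition sorted_reps {R : realType} (m : nat) (x : 'I_m -> R) : seq 'I_m :=
  sort (fun a b => (x a < x b) || ((x a == x b) && (a <= b)%N)) (enum 'I_m).

(* Index of the pivotal representative P:m, where
   P = min { j : sum_{k<=j} w_{k:m} > q^m }  (None if no such j) *)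
Definition pivotal {R : realType} (m : nat) (q : R) (w : 'I_m -> R)
  (x : 'I_m -> R) : option 'I_m :=
  let s := sorted_reps x in
  let j := find (fun n => quota q w < \sum_(k <- take n.+1 s) w k)
                (iota 0 (size s)) in
  ohead (drop j s).

Definition pivot_prob {d} {T : measurableType d} {R : realType}
  (P : probability T R) (m : nat) (q : R) (w : 'I_m -> R)
  (mu eps : 'I_m -> T -> R) (t : R) (i : 'I_m) : R :=
  fine (P [set om | pivotal q w (fun k => t * mu k om + eps k om) = Some i]).

(* Main.v *)
Require Import Defs.
From HB Require Import structures.
From mathcomp Require Import all_boot all_order all_algebra all_fingroup.
From mathcomp Require Import all_classical all_reals all_analysis.
From mathcomp Require Import measurable_realfun.
Import Order.TTheory GRing.Theory Num.Theory.
Import numFieldNormedType.Exports.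
Local Open Scope classical_set_scope.
Local Open Scope ring_scope.
Set Implicit Arguments.
Unset Strict Implicit.

(* The pivot depends only on the order of the ideal points.  The order of
   [t mu + eps] can differ from that of [mu] only when
   [t |mu_a - mu_b| <= |eps_a - eps_b|] for some [a != b]; these events decrease
   in [t] to a set on which two of the [mu_k] are tied, which is null because
   the [mu_k] are independent with a diffuse law.  Hence [pi_i] tends to the
   probability that [i] is pivotal for [mu].  The [mu_k] being exchangeable, the
   probability that [S] is the set of predecessors of [i] depends only on [#|S|];
   since for each [k < m] exactly one representative has [k] predecessors, it is
   [1 / ('C(m, k) * (m - k)) = k! (m - k - 1)! / m!], the Shapley coefficient. *)

(** * Rankings, the pivot, and the combinatorics of predecessor sets *)

Section rankings.
Context {R : realType} {m : nat}.
Implicit Types (x y : 'I_m -> R) (w : 'I_m -> R).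

(** Strict comparisons over all ordered pairs also fix the ties, so related profiles have the same
    sorted list, tie-breaking included. *)
Definition same_order x y := forall a b, (x a < x b) = (y a < y b).

Definition lower x (i : 'I_m) : {set 'I_m} := [set k | x k < x i]%SET.

Definition pivots_at (q : R) w (i : 'I_m) (S : {set 'I_m}) :=
  \sum_(k in S) w k <= quota q w < \sum_(k in i |: S) w k.

Lemma same_order_eq x y : same_order x y ->
  forall a b, (x a == x b) = (y a == y b).
Proof. by move=> xy a b; rewrite !eq_le !leNgt !xy. Qed.

Lemma same_order_lower x y i : same_order x y -> lower x i = lower y i.
Proof. by move=> xy; apply/setP => k; rewrite !inE xy. Qed.

Lemma same_order_inj x y : same_order x y -> injective x -> injective y.
Proof.
by move=> xy xI a b /eqP; rewrite -(same_order_eq xy) => /eqP /xI.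
Qed.

Lemma same_order_pivotal q w x y :
  same_order x y -> pivotal q w x = pivotal q w y.
Proof.
move=> xy; rewrite /pivotal; suff -> : sorted_reps x = sorted_reps y by [].
rewrite /sorted_reps; congr (sort _ _).
by apply/funext => a; apply/funext => b; rewrite xy (same_order_eq xy).
Qed.

(** Without ties, the entries sorted before [i] are exactly [lower x i], so the partial weight sums
    just before and just after [i] are the two sums in [pivots_at]. Nonnegative weights make partial
    sums monotone, hence two consecutive sums are enough to locate the first crossing of the
    quota. *)
Lemma pivotalP q w x i : injective x -> 0 <= quota q w -> (forall k, 0 <= w k) ->
  (pivotal q w x == Some i) = pivots_at q w i (lower x i).
Proof.
move=> xI q0 w0; set leT := fun a b : 'I_m =>
  (x a < x b) || ((x a == x b) && (a <= b)%N).
have leTE a b : leT a b = (x a <= x b).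
  rewrite /leT le_eqVlt orbC; case: eqP => //= /xI ->.
  by rewrite leqnn.
have leT_total : total leT by move=> a b; rewrite !leTE le_total.
have leT_tr : transitive leT by move=> a b c; rewrite !leTE; apply: le_trans.
have leT_refl : reflexive leT by move=> a; rewrite leTE.
set s := sorted_reps x.
have ss : sorted leT s by exact: sort_sorted.
have mem_s a : a \in s by rewrite mem_sort mem_enum.
have us : uniq s by rewrite sort_uniq enum_uniq.
have sz : size s = m by rewrite size_sort size_enum_ord.
have idx a b : (index a s < index b s)%N = (x a < x b).
  apply/idP/idP => [ab|]; last first.
    apply: contraTT; rewrite -leqNgt -leNgt => ba.
    by rewrite -leTE; apply: (sorted_leq_index leT_tr leT_refl ss).
  rewrite lt_neqAle; apply/andP; split.
    by apply: contraTneq ab => /xI ->; rewrite ltnn.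
  by rewrite -leTE; apply: (sorted_ltn_index leT_tr ss).
pose W n := \sum_(k <- take n s) w k.
have W_mono n n' : (n <= n')%N -> W n <= W n'.
  move=> nn'; rewrite -(subnKC nn') /W takeD big_cat lerDl /=.
  exact: sumr_ge0.
set n := index i s.
have n_lt : (n < size s)%N by rewrite index_mem.
have sum_take k (S : {set 'I_m}) : {in s, forall a, (a \in take k s) = (a \in S)} ->
    W k = \sum_(a in S) w a.
  move=> tS; rewrite /W -big_enum /=; apply: perm_big; apply: uniq_perm.
  - exact: take_uniq.
  - exact: enum_uniq.
  - by move=> a; rewrite mem_enum tS.
have Wn : W n = \sum_(k in lower x i) w k.
  by apply: sum_take => a sa; rewrite in_take// idx inE.
have WSn : W n.+1 = \sum_(k in i |: lower x i) w k.
  apply: sum_take => a sa; rewrite in_take// ltnS leqNgt idx !inE -leNgt le_eqVlt.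
  by congr (_ || _); apply/eqP/eqP => [/xI|->].
rewrite /pivots_at -Wn -WSn.
rewrite /pivotal -/s; set p := fun n => quota q w < W n.+1.
rewrite -/(W _) -/p.
set j := find p _.
(* The list has no duplicates, so only the position [j] of the first crossing matters. If nothing
   crosses, [j] is the length of [s] and [ohead] returns [None]. *)
have ->: (ohead (drop j s) == Some i) = (j == n).
  apply/eqP/eqP => [|->]; last first.
    by rewrite (drop_nth i n_lt) /= nth_index.
  have [jm|mj] := ltnP j (size s); last by rewrite drop_oversize.
  rewrite (drop_nth i jm) /= => -[ji].
  by rewrite /n -ji index_uniq.
have p_mono a b : (a <= b)%N -> p a -> p b.
  by move=> ab /lt_le_trans; apply; apply: W_mono; rewrite ltnS.
apply/eqP/andP => [jn|[Wq pn]].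
- split.
    (* In first position the preceding sum is empty and the nonnegative quota suffices. Otherwise
       the test [p] failed at [n'], and that test is about [W n'.+1], that is [W n]. *)
    case E : n => [|n']; first by rewrite /W take0 big_nil.
    have := @before_find _ 0%N p (iota 0 (size s)) n'.
    rewrite -/j jn E ltnSn nth_iota; last by rewrite (ltn_trans _ n_lt) ?E.
    by move=> /(_ isT); rewrite add0n /p leNgt => ->.
  have : has p (iota 0 (size s)) by rewrite has_find size_iota -/j jn.
  by move=> /(nth_find 0%N); rewrite -/j jn nth_iota.
- apply/eqP; rewrite eqn_leq; apply/andP; split.
  + rewrite leqNgt; apply/negP => nj.
    have := @before_find _ 0%N p (iota 0 (size s)) n nj.
    by rewrite nth_iota// add0n /p pn.
  + rewrite leqNgt; apply/negP => jn.
    have : has p (iota 0 (size s)).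
      by apply/hasP; exists n => //; rewrite mem_iota.
    move=> /(nth_find 0%N); rewrite -/j nth_iota ?(ltn_trans jn)// add0n /p.
    by rewrite ltNge (le_trans (W_mono _ _ jn) Wq).
Qed.

Lemma wvg_marginal q w i (S : {set 'I_m}) : (forall k, 0 <= w k) -> i \notin S ->
  wvg q w (i |: S) - wvg q w S = (pivots_at q w i S)%:R.
Proof.
move=> w0 iS; rewrite /wvg /pivots_at leNgt.
case: ltP => h1; case: ltP => h2 /=; rewrite ?subrr ?subr0//.
(* Remaining case: [S] wins and [i |: S] loses, which a nonnegative [w i] excludes. *)
have := lt_le_trans h2 (le_trans _ h1).
rewrite big_setU1//= lerDr w0 => /(_ isT).
by rewrite ltxx.
Qed.

Lemma lower_notin x i : i \notin lower x i.
Proof. by rewrite inE ltxx. Qed.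

Lemma lower_card_inj x : injective x -> injective (fun i => #|lower x i|).
Proof.
move=> xI; suff lt i j : x i < x j -> (#|lower x i| < #|lower x j|)%N.
  move=> i j /= ij; case: (ltgtP (x i) (x j)) => [/lt|/lt|/xI//]; by rewrite ij ltnn.
move=> ij; apply: proper_card; apply/properP; split.
  by apply/fintype.subsetP => k; rewrite !inE => /lt_trans; apply.
by exists i; rewrite !inE ?ltxx.
Qed.

Lemma lower_card_lt x i : (#|lower x i| < m)%N.
Proof.
rewrite -[X in (_ < X)%N]card_ord -cardsT; apply: proper_card.
by rewrite finset.properT; apply/eqP => /setP/(_ i); rewrite !inE ltxx.
Qed.

Lemma exists_rank x k : injective x -> (k < m)%N -> exists i, #|lower x i| = k.
Proof.
move=> xI km.
(* The number of predecessors is an injective map from ['I_m] to itself, hence onto. *)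
have fI : injective (fun i => Ordinal (lower_card_lt x i)).
  by move=> a b /(congr1 val)/= /(lower_card_inj xI).
have [g _ gK] := injF_bij fI.
by exists (g (Ordinal km)); have /(congr1 val) := gK (Ordinal km).
Qed.

Lemma lower_perm x (s : {perm 'I_m}) i :
  lower (x \o s) i = (s @^-1: lower x (s i))%SET.
Proof. by apply/setP => k; rewrite !inE. Qed.

End rankings.

(* Two listings of ['I_m] of the form [S, i, rest] are matched entry by entry. *)
Lemma perm_matching {m : nat} (i j : 'I_m) (S S' : {set 'I_m}) :
  i \notin S -> j \notin S' -> #|S| = #|S'| ->
  exists s : {perm 'I_m}, s i = j /\ (s @^-1: S')%SET = S.
Proof.
pose l (i : 'I_m) (S : {set 'I_m}) := enum S ++ i :: enum (~: (i |: S))%SET.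
have l_uniq a (A : {set 'I_m}) : a \notin A -> uniq (l a A).
  move=> aA; rewrite cat_uniq /= !enum_uniq /= andbT !mem_enum (negbTE aA) /=.
  rewrite !inE eqxx /= andbT; apply/hasPn => b.
  by rewrite !mem_enum !inE negb_or => /andP[].
have l_mem a (A : {set 'I_m}) b : b \in l a A.
  rewrite mem_cat inE !mem_enum !inE.
  by case: (b \in A) => //=; case: (b == a).
have l_size a (A : {set 'I_m}) : a \notin A -> size (l a A) = m.
  move=> aA; rewrite -[RHS]card_ord -(card_uniqP (l_uniq _ _ aA)).
  by apply: eq_card => b; rewrite l_mem inE.
move=> iS jS SS'.
pose f a := nth j (l j S') (index a (l i S)).
have idx a : (index a (l i S) < m)%N.
  by have := l_mem i S a; rewrite -index_mem l_size.
have fI : injective f.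
  move=> a b /eqP; rewrite /f nth_uniq ?l_size// ?l_uniq//.
  by move=> /eqP /(index_inj j (l_mem _ _ _)); apply.
exists (perm fI); rewrite permE; split.
  rewrite /f /l index_cat mem_enum (negbTE iS) /= eqxx addn0.
  by rewrite -cardE SS' nth_cat -cardE ltnn subnn.
apply/setP => a; rewrite inE permE /f.
have aE : (a \in S) = (index a (l i S) < #|S|)%N.
  rewrite cardE index_cat -mem_enum -index_mem.
  case: ifP => [->//|_]; by rewrite ltnNge leq_addr.
rewrite aE SS'; set n := index _ _; rewrite nth_cat -cardE.
case: ltnP => n_lt; first by rewrite -mem_enum mem_nth// -cardE.
(* Offset 0 is [j], which lies outside [S']. Larger offsets fall in the complement of [j |: S'], or
   past the end of the list, where the default value is again [j]. *)
case: (n - _)%N => [|n'] /=; first exact/negbTE.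
have [n'_lt|] := ltnP n' (size (enum (~: (j |: S'))%SET)); last first.
  by move=> /(nth_default j) ->; exact/negbTE.
have := mem_nth j n'_lt; rewrite mem_enum !inE negb_or => /andP[_].
by move/negbTE.
Qed.

Lemma card_pointed_subsets (m k : nat) :
  #|[set p : 'I_m * {set 'I_m} | (p.1 \notin p.2) && (#|p.2| == k)]%SET| =
  ('C(m, k) * (m - k))%N.
Proof.
rewrite -sum1_card (eq_bigl (fun p : 'I_m * {set 'I_m} =>
  (#|p.2| == k) && (p.1 \notin p.2))); last first.
  by move=> p; rewrite inE andbC.
rewrite (reindex (fun p : {set 'I_m} * 'I_m => (p.2, p.1))) /=; last first.
  by exists (fun p => (p.2, p.1)) => -[].
rewrite -(pair_big_dep (fun A : {set 'I_m} => #|A| == k)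
  (fun A i => i \notin A) (fun _ _ => 1%N)) /=.
rewrite (eq_bigr (fun=> (m - k)%N)) => [|A /eqP Ak].
  rewrite sum_nat_const; congr (_ * _)%N.
  by rewrite -[m in RHS]card_ord -card_draws; apply: eq_card => A; rewrite !inE.
rewrite sum1_card -Ak -[X in (X - _)%N](card_ord m) -(cardsC A) addKn.
by apply: eq_card => i; rewrite !inE.
Qed.

(** * Events determined by the order, and uniqueness of the joint law *)

(** Only finitely many comparison patterns [lts x] exist. An order-invariant event is a finite union
    of patterns, each a finite intersection of measurable comparisons. *)
Lemma measurable_order_event d (T : measurableType d) (R : realType) (m : nat)
  (X : 'I_m -> T -> R) (Phi : ('I_m -> R) -> Prop) :
  (forall k, measurable_fun setT (X k)) ->
  (forall x y, same_order x y -> Phi x -> Phi y) ->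
  measurable [set om | Phi (X ^~ om)].
Proof.
move=> mX PhiP.
pose lts x := [set p : 'I_m * 'I_m | x p.1 < x p.2 :> R]%SET.
have ltsE x y : lts x = lts y -> same_order x y.
  by move=> /setP xy a b; have := xy (a, b); rewrite !inE.
rewrite (_ : [set om | _] = \bigcup_(A in [set A | exists2 x, lts x = A & Phi x])
    \bigcap_(p in [set: 'I_m * 'I_m])
      ((fun om => X p.1 om < X p.2 om) @^-1` [set p \in A])).
  apply: fin_bigcup_measurable => // A _.
  apply: fin_bigcap_measurable => // -[a b] _ /=.
  rewrite -[X in measurable X]setTI.
  by apply: measurable_fun_ltr.
apply/seteqP; split => om /=.
  move=> Pom; exists (lts (X ^~ om)); first by exists (X ^~ om).
  by move=> p _ /=; rewrite inE.
move=> [A [x xA Px] XA]; apply: PhiP Px; apply: ltsE; rewrite xA.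
by apply/setP => p; rewrite inE; rewrite (XA p).
Qed.

Section joint_law.
Context d (T : measurableType d) (R : realType) (P : probability T R) (m : nat).
Implicit Types X Y : 'I_m -> T -> R.

(** A pi-system of products of Borel sets; the sigma-algebra it generates plays the role of the
    product one on ['I_m -> R]. *)
Let boxes : set (set ('I_m -> R)) :=
  [set A | exists2 B : 'I_m -> set R, (forall i, measurable (B i)) &
    A = [set x | forall i, B i (x i)]].

Let measurable_joint X : (forall k, measurable_fun setT (X k)) ->
  measurable_fun setT (fun om => X ^~ om : g_sigma_algebraType boxes).
Proof.
move=> mX; apply: (@measurability _ _ _ (g_sigma_algebraType boxes) _ _ boxes) => //
  _ [_ [B mB ->] <-].
rewrite setTI (_ : _ @^-1` _ = \bigcap_(i in [set: 'I_m]) (X i @^-1` B i)).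
  by apply: fin_bigcap_measurable => // i _; rewrite -[X in measurable X]setTI; apply: mX.
by apply/seteqP; split => om /= XB i; [move=> _|]; apply: XB.
Qed.

(** Independence and equal marginals make the two joint laws agree on boxes, and a finite measure is
    determined by its values on a generating pi-system. The event is measurable on the space of
    profiles because [measurable_order_event] applies to the coordinate maps. *)
Lemma joint_law_unique X Y (Phi : ('I_m -> R) -> Prop) :
  (forall k, measurable_fun setT (X k)) ->
  (forall k, measurable_fun setT (Y k)) ->
  mutually_independent P X -> mutually_independent P Y ->
  (forall k B, measurable B -> P (X k @^-1` B) = P (Y k @^-1` B)) ->
  (forall x y, same_order x y -> Phi x -> Phi y) ->
  P [set om | Phi (X ^~ om)] = P [set om | Phi (Y ^~ om)].
Proof.
move=> mX mY iX iY XY PhiP.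
pose fX : {mfun T >-> g_sigma_algebraType boxes} := mfun_Sub (mem_set (measurable_joint mX)).
pose fY : {mfun T >-> g_sigma_algebraType boxes} := mfun_Sub (mem_set (measurable_joint mY)).
have mproj k : measurable_fun setT (fun x : g_sigma_algebraType boxes => x k).
  move=> _ B mB; rewrite setTI; apply: sub_sigma_algebra.
  exists (fun i => if i == k then B else setT) => [i|]; first by case: ifP.
  apply/seteqP; split => x /= => [xB i|/(_ k)]; last by rewrite eqxx.
  by case: eqP => [->|].
suff : distribution P fX [set x | Phi x] = distribution P fY [set x | Phi x] by [].
apply: (@measure_unique _ R (g_sigma_algebraType boxes) boxes (fun=> setT)
  _ _ _ _ (distribution P fX) (distribution P fY)) => //.
- move=> _ _ [B mB ->] [C mC ->]; exists (fun i => B i `&` C i).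
    by move=> i; apply: measurableI.
  apply/seteqP; split => x /=; first by move=> [xB xC] i; split; [apply: xB|apply: xC].
  by move=> xBC; split=> i; have [] := xBC i.
- by move=> _; exists (fun=> setT) => //; apply/seteqP; split.
- by rewrite bigcup_const.
- move=> _ [B mB ->].
  have E Z : P [set om | forall i, B i (Z i om)] =
      P (\bigcap_(i in [set: 'I_m]) (Z i @^-1` B i)).
    by congr (P _); apply/seteqP; split => om /= ZB i; [move=> _|]; apply: ZB.
  change (P [set om | forall i, B i (X i om)] = P [set om | forall i, B i (Y i om)]).
  rewrite !E iX// iY//.
  by apply: eq_bigr => k _; exact: XY.
- by move=> k; exact: (le_lt_trans (probability_le1 _ _) (ltry _)).
- exact: (@measurable_order_event _ (g_sigma_algebraType boxes) _ _ (fun k x => x k)).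
Qed.

End joint_law.

(** * Ties between independent variables, and auxiliary bounds on measures *)

Section ties.
Context d (T : measurableType d) (R : realType) (P : probability T R).

(** By independence the joint law is the product measure. The sections of the diagonal are single
    points, null for the law of [Y], so the integral of their measures vanishes. *)
Lemma probability_tie (X Y : {RV P >-> R}) :
  (forall A B, measurable A -> measurable B ->
    P (X @^-1` A `&` Y @^-1` B) = P (X @^-1` A) * P (Y @^-1` B))%E ->
  (forall y, P (Y @^-1` [set y]) = 0%E) ->
  P [set om | X om = Y om] = 0%E.
Proof.
move=> XYi Y0.
have mXY : measurable_fun setT (fun om => (X om, Y om)).
  exact: measurable_fun_pair.
pose XY : {mfun T >-> (R * R)%type} := mfun_Sub (mem_set mXY).
pose D := [set p : R * R | p.1 = p.2].
have mD : measurable D.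
  rewrite (_ : D = (fun p => p.1 == p.2) @^-1` [set true]).
    rewrite -[X in measurable X]setTI.
    by apply: measurable_fun_eqr.
  by apply/seteqP; split => p /eqP.
transitivity (distribution P XY D); first by [].
rewrite -(@product_measure_unique _ _ _ _ _ (distribution P X) (distribution P Y))//.
rewrite /product_measure1; apply: integral0_eq => x _ /=.
rewrite (_ : xsection D x = [set x]) ?Y0//.
  exact: Y0.
apply/seteqP; split => y /=; rewrite /xsection /= inE /D /=; by move=> ->.
Qed.

End ties.

Lemma measure_bigcup_finType d (T : measurableType d) (R : realType)
  (mu : {measure set T -> \bar R}) (I : finType) (D : pred I) (F : I -> set T) :
  (forall i, measurable (F i)) -> trivIset [set` D] F ->
  mu (\bigcup_(i in [set` D]) F i) = (\sum_(i | D i) mu (F i))%E.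
Proof.
move=> mF tF; rewrite measure_fin_bigcup//.
rewrite (fsbigE (enum D)) ?enum_uniq//; last 2 first.
- by move=> i; rewrite /= mem_enum.
- by move=> i /= Di; rewrite mem_enum => /negP[].
rewrite big_enum_cond; apply: eq_bigl => i.
by rewrite mem_setE andbb.
Qed.

Lemma fine_probability_dist_le d (T : measurableType d) (R : realType)
  (P : probability T R) (A B C : set T) :
  measurable A -> measurable B -> measurable C ->
  A `<=` B `|` C -> B `<=` A `|` C ->
  `|fine (P A) - fine (P B)| <= fine (P C).
Proof.
move=> mA mB mC.
have le U V : measurable U -> measurable V -> U `<=` V `|` C ->
    fine (P U) <= fine (P V) + fine (P C).
  move=> mU mV UVC; rewrite -lee_fin EFinD !fineK ?fin_num_measure//.
  apply: (le_trans _ (measureU2 P mV mC)).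
  by apply: le_measure; rewrite ?inE//; apply: measurableU.
by move=> AB BA; rewrite ler_distl lerBlDr !le.
Qed.

(** * Exchangeable ideal points: the pivot law is the Shapley value *)

Section exchangeable.
Context d (T : measurableType d) (R : realType) (P : probability T R) (m : nat).
Variable X : 'I_m -> {RV P >-> R}.
Hypothesis indep : mutually_independent P (fun k => X k : T -> R).
Hypothesis ident : forall k l B, measurable B -> P (X k @^-1` B) = P (X l @^-1` B).
Hypothesis diffuse : forall k y, P (X k @^-1` [set y]) = 0%E.

Let x (om : T) : 'I_m -> R := fun k => X k om.

Lemma measurable_event (Phi : ('I_m -> R) -> Prop) :
  (forall y z, same_order y z -> Phi y -> Phi z) ->
  measurable [set om | Phi (x om)].
Proof. by move=> PhiP; apply: measurable_order_event PhiP => k. Qed.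

Lemma pairwise_independent a b A B : a != b -> measurable A -> measurable B ->
  P (X a @^-1` A `&` X b @^-1` B) = (P (X a @^-1` A) * P (X b @^-1` B))%E.
Proof.
move=> ab mA mB.
pose C k := if k == a then A else if k == b then B else setT.
have Ca : C a = A by rewrite /C eqxx.
have Cb : C b = B by rewrite /C eqxx eq_sym (negbTE ab).
have := @indep C; rewrite (_ : \bigcap_(i in _) _ = X a @^-1` A `&` X b @^-1` B).
  move=> ->; last by move=> k; rewrite /C; case: ifP => // _; case: ifP.
  rewrite (bigD1 a)//= (bigD1 b)/=; last by rewrite eq_sym.
  rewrite big1 ?mule1 ?Ca ?Cb// => k /andP[/negbTE ka /negbTE kb].
  by rewrite /C ka kb preimage_setT probability_setT.
apply/seteqP; split => om /=.
  by move=> XC; split; [rewrite -Ca|rewrite -Cb]; apply: XC.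
by move=> [XA XB] k _; rewrite /= /C; case: eqP => [->|_] //; case: eqP => [->|].
Qed.

Lemma negligible_ties : P.-negligible [set om | ~ injective (x om)].
Proof.
(* The pairs are enumerated by [unpickle], with [set0] at codes of no pair, which turns the union
   over pairs into a countable one. *)
pose F n := if (unpickle n : option ('I_m * 'I_m)) is Some p then
  [set om | p.1 != p.2 /\ x om p.1 = x om p.2] else set0.
apply: (@negligibleS _ _ _ P (\bigcup_n F n)).
  move=> om /= nI; apply: contrapT => nF; apply: nI => a b ab.
  apply/eqP/negPn/negP => neq; apply: nF; exists (pickle (a, b)) => //.
  by rewrite /F pickleK.
apply: negligible_bigcup => n; rewrite /F; case: (unpickle n) => [[a b]|];
  last exact: negligible_set0.
have [->|ab] /= := eqVneq a b.
  rewrite (_ : [set _ | _] = set0); [exact: negligible_set0|].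
  by apply/seteqP; split => // om [].
exists [set om | X a om = X b om]; split; last by move=> om [].
  rewrite (_ : mkset _ = [set om | x om a = x om b])//.
  apply: (measurable_event (Phi := fun y => y a = y b)) => y z yz /eqP.
  by rewrite (same_order_eq yz) => /eqP.
apply: probability_tie => // A B mA mB; exact: pairwise_independent.
Qed.

(** Excluding ties makes these events disjoint when the pair of [i] and [S] varies with [#|S|]
    fixed: distinct representatives then have different numbers of predecessors. *)
Definition rank_event i (S : {set 'I_m}) :=
  [set om | injective (x om) /\ lower (x om) i = S].

Lemma measurable_injective : measurable [set om | injective (x om)].
Proof. by apply: measurable_event => y z; apply: same_order_inj. Qed.

Lemma same_order_rank i S (y z : 'I_m -> R) : same_order y z ->
  injective y /\ lower y i = S -> injective z /\ lower z i = S.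
Proof.
by move=> yz [yI <-]; split; [exact: same_order_inj yI|rewrite (same_order_lower _ yz)].
Qed.

Lemma measurable_rank_event i S : measurable (rank_event i S).
Proof.
apply: (measurable_event (Phi := fun y => injective y /\ lower y i = S)) => y z.
exact: same_order_rank.
Qed.

Lemma probability_setI_injective A : measurable A ->
  P A = P (A `&` [set om | injective (x om)]).
Proof.
move=> mA; rewrite (measureDI P mA measurable_injective).
rewrite [X in (X + _)%E](_ : _ = 0%E) ?add0e//.
apply: measure_negligible; first exact: measurableD mA measurable_injective.
by apply: negligibleS negligible_ties => om [].
Qed.

Lemma permuted_independent (s : {perm 'I_m}) :
  mutually_independent P (fun k => X (s k) : T -> R).
Proof.
move=> B mB.
rewrite (_ : \bigcap_(i in _) _ =
    \bigcap_(i in [set: 'I_m]) (X i @^-1` B ((s^-1)%g i))).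
  rewrite indep// (reindex_inj (@perm_inj _ s)) /=.
  by apply: eq_bigr => k _; rewrite permK.
apply/seteqP; split => om /= XB k _ /=.
  by have /= := XB ((s^-1)%g k) I; rewrite permKV.
by have /= := XB (s k) I; rewrite permK.
Qed.

(** A permutation taking [i] to [j] and pulling [S'] back to [S] turns one event into the other by
    [lower_perm], and relabelling an independent, identically distributed family preserves its joint
    law on order events. *)
Lemma rank_event_symmetry i j (S S' : {set 'I_m}) :
  i \notin S -> j \notin S' -> #|S| = #|S'| ->
  P (rank_event i S) = P (rank_event j S').
Proof.
move=> iS jS' /(perm_matching iS jS')[s [sij sS]].
rewrite /rank_event.
rewrite (@joint_law_unique _ _ _ P m (fun k => X k) (fun k => X (s k))
  (fun y => injective y /\ lower y i = S))//; last 3 first.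
- exact: permuted_independent.
- by move=> k B mB; exact: ident.
- by move=> y z; exact: same_order_rank.
congr (P _); apply/seteqP; split => om /= [xI xS].
- split.
    move=> a b ab; apply: (perm_inj (s := s^-1%g)).
    by apply: xI; rewrite !permKV.
  apply/setP => k; have : lower (x om \o s) i = S := xS.
  rewrite lower_perm sij -sS => /setP/(_ ((s^-1)%g k)).
  by rewrite !inE permKV.
- split; first by move=> a b /xI /perm_inj.
  by rewrite -sS -xS -sij -lower_perm.
Qed.

Lemma rank_event_prob i (S : {set 'I_m}) : i \notin S ->
  P (rank_event i S) = (((#|S|)`! * (m - #|S| - 1)`!)%:R / (m`!)%:R)%:E.
Proof.
move=> iS; set k := #|S|.
have km : (k < m)%N.
  rewrite -[m]card_ord -cardsT; apply: proper_card; rewrite finset.properT.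
  by apply: contraNneq iS => ->; rewrite inE.
pose D : pred ('I_m * {set 'I_m}) := fun p => (p.1 \notin p.2) && (#|p.2| == k).
(* Off the ties exactly one representative has [k] predecessors, so the events indexed by [D]
   partition the space up to a null set. *)
have sum1 : (\sum_(p | D p) P (rank_event p.1 p.2))%E = 1%E.
  rewrite -measure_bigcup_finType; last 2 first.
  - by move=> p; apply: measurable_rank_event.
  - move=> [a A] [b B] /= /andP[aA /eqP Ak] /andP[bB /eqP Bk] [om /= [[xI lA] [_ lB]]].
    have ab : a = b by apply: (lower_card_inj xI); rewrite lA lB Ak Bk.
    by rewrite -lA -lB ab.
  rewrite -(@probability_setT _ _ _ P) [RHS](probability_setI_injective measurableT) setTI.
  congr (P _); apply/seteqP; split => om /=; first by move=> [p _ []].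
  move=> xI; have [a ak] := exists_rank xI km.
  by exists (a, lower (x om) a) => //; apply/andP; split; [exact: lower_notin|exact/eqP].
move: sum1; rewrite (eq_bigr (fun=> P (rank_event i S))); last first.
  by move=> p /andP[pS /eqP pk]; apply: rank_event_symmetry.
have /fineK <- : P (rank_event i S) \is a fin_num.
  by apply: fin_num_measure; apply: measurable_rank_event.
move: (fine _) => r; rewrite sumEFin => -[].
rewrite sumr_const -(eq_card (A := [set p | D p]%SET)); last by move=> p; rewrite inE.
rewrite card_pointed_subsets => E; congr (_%:E).
have mf0 n : (n`!)%:R != 0 :> R by rewrite pnatr_eq0 -lt0n fact_gt0.
apply: (mulIf (mf0 m)); rewrite divfK//.
(* As [k < m], the factor [m - k] can be split off [(m - k)!]; then [m!] is the number of pairs in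
   [D] times the numerator of the Shapley coefficient. *)
have mk : ((m - k)`! = (m - k) * (m - k - 1)`!)%N.
  by move: km; rewrite -subn_gt0 subn1; case: (m - k)%N.
have -> : (m`! = 'C(m, k) * (m - k) * (k`! * (m - k - 1)`!))%N.
  by rewrite -(bin_fact (ltnW km)) mk -mulnA; congr (_ * _)%N; exact: mulnCA.
by rewrite natrM mulrA (mulr_natr r) E mul1r.
Qed.

(** The event is split by the predecessor set of [i]. By [wvg_marginal] the sets at which [i] pivots
    are those of marginal contribution 1, and each contributes its Shapley coefficient. *)
Lemma probability_pivotal q (w : 'I_m -> R) i :
  0 <= quota q w -> (forall k, 0 <= w k) ->
  P [set om | pivotal q w (x om) = Some i] = (shapley (wvg q w) i)%:E.
Proof.
move=> q0 w0; rewrite probability_setI_injective; last first.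
  apply: (measurable_event (Phi := fun y => pivotal q w y = Some i)) => y z yz.
  by rewrite (same_order_pivotal _ _ yz).
rewrite (_ : _ `&` _ = \bigcup_(S in [set`
    [pred S : {set 'I_m} | (i \notin S) && pivots_at q w i S]]) rank_event i S).
  rewrite measure_bigcup_finType; last 2 first.
  - by move=> S; apply: measurable_rank_event.
  - by move=> S S' _ _ [om [[_ <-] [_ <-]]].
  rewrite /shapley -sumEFin big_mkcondr /=; apply: eq_bigr => S iS.
  rewrite wvg_marginal//; case: ifP => _; last by rewrite mulr0.
  by rewrite mulr1 rank_event_prob.
apply/seteqP; split => om /=.
  move=> [/eqP piv xI]; exists (lower (x om) i) => //=.
  by apply/andP; split; [exact: lower_notin|rewrite -pivotalP].
move=> [S /= /andP[iS pS] [xI lS]]; split=> //.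
by apply/eqP; rewrite pivotalP// lS.
Qed.

End exchangeable.

(** * Vanishing influence of the perturbation *)

(** The difference of the two sides is [t * (u - u') + (v - v')]. The hypothesis forces [t > 0] and
    makes the first term dominate, so the sign is that of [u - u']. *)
Lemma scaled_perturbation_lt (R : realDomainType) (t u u' v v' : R) :
  `|v - v'| < t * `|u - u'| -> (t * u + v < t * u' + v') = (u < u').
Proof.
move=> h.
have h0 : 0 < t * `|u - u'| by exact: le_lt_trans h.
have uu : 0 < `|u - u'|.
  by rewrite lt_neqAle normr_ge0 andbT; apply: contraTneq h0 => <-; rewrite mulr0 ltxx.
have t0 : 0 < t by rewrite -(pmulr_lgt0 _ uu).
rewrite -subr_lt0 -[RHS]subr_lt0.
rewrite (_ : _ - _ = t * (u - u') + (v - v')); last by rewrite mulrBr addrACA opprD.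
move: h; rewrite ltr_norml; case: (ltgtP (u - u') 0) uu => [lt|gt|->];
  last by rewrite normr0 ltxx.
- by rewrite ltr0_norm// mulrN => _ /andP[_ h]; rewrite -ltrBrDl sub0r.
- rewrite gtr0_norm// => _ /andP[h _].
  by apply/negbTE; rewrite -leNgt -lerBlDl sub0r ltW.
Qed.

Section perturbation.
Context d (T : measurableType d) (R : realType) (P : probability T R) (m : nat).
Variables mu eps : 'I_m -> {RV P >-> R}.

(** An integer index yields a decreasing sequence of events, suited to continuity from above;
    outside the [n]-th one the order is that of [mu] for every real [t >= n]. *)
Definition close_pair (n : nat) : set T :=
  \bigcup_(p in [set p : 'I_m * 'I_m | p.1 != p.2])
    [set om | n%:R * `|mu p.1 om - mu p.2 om| <= `|eps p.1 om - eps p.2 om|].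

Lemma measurable_close_pair n : measurable (close_pair n).
Proof.
apply: fin_bigcup_measurable => // -[a b] _ /=.
have : measurable_fun setT (fun om =>
    n%:R * `|mu a om - mu b om| <= `|eps a om - eps b om|).
  apply: measurable_fun_ler.
    by apply: measurable_funM => //; apply: measurableT_comp => //; exact: measurable_funB.
  by apply: measurableT_comp => //; exact: measurable_funB.
by move=> /(_ measurableT [set true]); rewrite setTI; exact.
Qed.

Lemma close_pair_cvg0 : P.-negligible [set om | ~ injective (mu ^~ om)] ->
  fine (P (close_pair n)) @[n --> \oo] --> 0.
Proof.
move=> ties.
have mcap : measurable (\bigcap_n close_pair n).
  by apply: bigcapT_measurable => n; exact: measurable_close_pair.
apply: fine_cvg.
suff <- : P (\bigcap_n close_pair n) = 0%:E.
  apply: nonincreasing_cvg_mu => //.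
  - exact: le_lt_trans (probability_le1 P (measurable_close_pair 0)) (ltry _).
  - exact: measurable_close_pair.
  - move=> n n' nn'; apply/subsetPset => om [p p12 h]; exists p => //=.
    by apply: le_trans h; rewrite ler_wpM2r// ler_nat.
apply: measure_negligible => //; apply: negligibleS ties => om h muI.
(* Off the ties a denominator vanishes only for equal indices, where the ratio is 0. *)
pose r (p : 'I_m * 'I_m) := `|eps p.1 om - eps p.2 om| / `|mu p.1 om - mu p.2 om|.
have r0 p : 0 <= r p by exact: divr_ge0.
(* The ratios being nonnegative, their sum dominates each of them; an integer above it puts the
   outcome outside the corresponding [close_pair]. *)
have [|p p12 /=] := h (Num.bound (\sum_p r p)); first by [].
have dp : 0 < `|mu p.1 om - mu p.2 om|.
  by rewrite normr_gt0 subr_eq0; apply: contra_neq p12 => /muI.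
rewrite -ler_pdivlMr// leNgt => /negP; apply.
apply: le_lt_trans (archi_boundP (sumr_ge0 _ (fun p _ => r0 p))).
by rewrite (bigD1 p)//= lerDl sumr_ge0.
Qed.

Lemma same_order_perturbed n t om : n%:R <= t -> ~ close_pair n om ->
  same_order (fun k => t * mu k om + eps k om) (mu ^~ om).
Proof.
move=> nt far a b; have [->|ab] := eqVneq a b; first by rewrite !ltxx.
apply: scaled_perturbation_lt; rewrite ltNge; apply/negP => h; apply: far.
by exists (a, b) => //=; apply: le_trans h; rewrite ler_wpM2r.
Qed.

(** For [t] at least [N], the perturbed and unperturbed pivots coincide outside [close_pair N], so
    the two probabilities differ by at most the probability of that event, which is small for a
    suitable fixed [N]. *)
Lemma pivot_prob_cvg q (w : 'I_m -> R) i :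
  P.-negligible [set om | ~ injective (mu ^~ om)] ->
  pivot_prob P q w (fun k => mu k) (fun k => eps k) t i @[t --> +oo] -->
    fine (P [set om | pivotal q w (mu ^~ om) = Some i]).
Proof.
move=> /close_pair_cvg0 C0; apply/cvgrPdist_le => e e0.
have /cvgrPdist_le /(_ e e0) [N _ /(_ N (leqnn _)) PN] := C0.
rewrite sub0r normrN in PN.
near=> t.
have Nt : N%:R <= t by near: t; exact: nbhs_pinfty_ge.
have mpiv (X : 'I_m -> T -> R) : (forall k, measurable_fun setT (X k)) ->
    measurable [set om | pivotal q w (X ^~ om) = Some i].
  move=> mX; apply: (measurable_order_event
    (Phi := fun y => pivotal q w y = Some i)) => // y z yz.
  by rewrite (same_order_pivotal _ _ yz).
apply: le_trans (le_trans (ler_norm _) PN).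
apply: fine_probability_dist_le.
- exact: mpiv.
- apply: (mpiv (fun k om => t * mu k om + eps k om)) => k.
  by apply: measurable_funD => //; apply: measurable_funM.
- exact: measurable_close_pair.
- move=> om /= piv; have [?|/(same_order_perturbed Nt) so] := pselect (close_pair N om);
    first by right.
  by left; rewrite /= (same_order_pivotal _ _ so).
- move=> om /= piv; have [?|/(same_order_perturbed Nt) so] := pselect (close_pair N om);
    first by right.
  by left; rewrite /= -(same_order_pivotal _ _ so).
Unshelve. all: by end_near.
Qed.

End perturbation.

(** * Convergence of the ratio of pivot probabilities *)

Unset Implicit Arguments.
Set Strict Implicit.

Theorem theorem2 (d : measure_display) (T : measurableType d) (R : realType)
  (P : probability T R) (m : nat) (q : R) (w : 'I_m -> R)
  (mu eps : 'I_m -> {RV P >-> R}) (f : R -> R) :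
  1 / 2 <= q -> q < 1 ->
  (forall j, 0 <= w j) -> 0 < \sum_(j < m) w j ->
  mutually_independent P
    (fun k : 'I_m + 'I_m => match k with inl a => (mu a : T -> R)
                                       | inr a => (eps a : T -> R) end) ->
  (forall k, P.-integrable setT (EFin \o eps k)) ->
  (forall k, P.-integrable setT (EFin \o (fun om => eps k om ^+ 2))) ->
  measurable_fun setT f -> (forall x, 0 <= f x) ->
  (exists M : R, forall x, f x <= M) ->
  (forall k (A : set R), measurable A ->
     P (mu k @^-1` A) = (\int[lebesgue_measure]_(x in A) (f x)%:E)%E) ->
  forall i j : 'I_m, 0 < shapley (wvg q w) j ->
  (fun t => pivot_prob P q w mu eps t i / pivot_prob P q w mu eps t j)
    @ +oo --> shapley (wvg q w) i / shapley (wvg q w) j.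
Proof.
move=> q_half _ w0 wsum indep _ _ _ _ _ density i j shapley_j.
have q0 : 0 <= quota q w.
  by rewrite mulr_ge0// ?ltW// (lt_le_trans _ q_half)// divr_gt0.
have indep_mu : mutually_independent P (fun k => mu k : T -> R).
  move=> B mB.
  (* Taking [setT] for each [eps] removes these variables from the product rule. *)
  have := indep (fun k => if k is inl a then B a else setT).
  rewrite (_ : \bigcap_(k in _) _ = \bigcap_(a in [set: 'I_m]) (mu a @^-1` B a)).
    move=> ->; last by case.
    rewrite big_sumType /= [X in (_ * X)%E]big1 ?mule1// => a _.
    by rewrite preimage_setT probability_setT.
  apply/seteqP; split => om /= XB; first by move=> a _; exact: (XB (inl a)).
  by move=> [a|a] _ //=; exact: XB.
(* The common density gives equal laws and, points being Lebesgue-null, laws without atoms. *)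
have ident k l (B : set R) : measurable B -> P (mu k @^-1` B) = P (mu l @^-1` B).
  by move=> mB; rewrite !density.
have diffuse k y : P (mu k @^-1` [set y]) = 0%E.
  by rewrite density// integral_set1.
have lim k : pivot_prob P q w mu eps t k @[t --> +oo] --> shapley (wvg q w) k.
  have := @pivot_prob_cvg _ _ _ P m mu eps q w k (negligible_ties indep_mu diffuse).
  by rewrite probability_pivotal.
(* Inversion is continuous at the limit of the denominator, since [shapley_j] makes it nonzero. *)
by apply: cvgM (lim i) (cvgV _ (lim j)); rewrite gt_eqF.
Qed.
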